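(* For every $\mathfrak u\in\boldsymbol\beta\omega\setminus\omega$ the following are equivalent: (i) $\mathfrak u$ is a weak $P$-point; (iia) for all $f:\omega\to\boldsymbol\beta\omega$ and $\mathfrak v\in\boldsymbol\beta\omega$ such that $\mathfrak u=\widetilde f(\mathfrak v)$ there exists $i\in\omega$ satisfying $f(i)=\mathfrak u$ or $f(i)\in\omega$; (iib) for all $f:\omega\to\boldsymbol\beta\omega$ and $\mathfrak v\in\boldsymbol\beta\omega$ such that $\mathfrak u=\widetilde f(\mathfrak v)$, one of the two sets $\{i\in\omega:f(i)=\mathfrak u\}$ and $\{i\in\omega:f(i)\in\omega\}$ belongs to $\mathfrak v$; (iiia) for all $g:\omega^2\to\omega$ and $\mathfrak v,\mathfrak w\in\boldsymbol\beta\omega$ such that $\mathfrak u=\widetilde g(\mathfrak v,\mathfrak w)$ there exists $i\in\omega$ satisfying $\widetilde g(i,\mathfrak w)=\mathfrak u$ or $\widetilde g(i,\mathfrak w)\in\omega$; (iiib) for all $g:\omega^2\to\omega$ and $\mathfrak v,\mathfrak w\in\boldsymbol\beta\omega$ such that $\mathfrak u=\widetilde g(\mathfrak v,\mathfrak w)$, one of the two sets $\{i\in\omega:\widetilde g(i,\mathfrak w)=\mathfrak u\}$ and $\{i\in\omega:\widetilde g(i,\mathfrak w)\in\omega\}$ belongs to $\mathfrak v$.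
   Context: $\boldsymbol\beta\omega$ is the set of all ultrafilters over $\omega$, with $n\in\omega$ identified with the principal ultrafilter at $n$ (so $\omega\subseteq\boldsymbol\beta\omega$), topologized by the basic open sets $\{\mathfrak u:A\in\mathfrak u\}$, $A\subseteq\omega$. For $f:\omega\to\boldsymbol\beta\omega$, $\widetilde f:\boldsymbol\beta\omega\to\boldsymbol\beta\omega$ is the unique continuous extension of $f$. For $g:\omega^2\to\omega$, its ultrafilter extension $\widetilde g:(\boldsymbol\beta\omega)^2\to\boldsymbol\beta\omega$ is defined by $S\in\widetilde g(\mathfrak v,\mathfrak w)$ iff $\{x\in\omega:\{y\in\omega:g(x,y)\in S\}\in\mathfrak w\}\in\mathfrak v$, for $S\subseteq\omega$. An ultrafilter $\mathfrak u\in\boldsymbol\beta\omega\setminus\omega$ is a weak $P$-point iff $\mathfrak u$ does not belong to the closure of any countable set $A\subseteq\boldsymbol\beta\omega\setminus(\omega\cup\{\mathfrak u\})$. *)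

(* Defs.v *)
From HB Require Import structures.
From mathcomp Require Import all_boot all_order all_algebra.
From mathcomp Require Import all_classical topology.

Set Implicit Arguments.
Unset Strict Implicit.
Unset Printing Implicit Defensive.

Local Open Scope classical_set_scope.

Record betaomega := BetaOmega {
  ultra_sets :> set nat -> Prop;
  ultra_setsP : UltraFilter ultra_sets }.

#[global] Existing Instance ultra_setsP.

HB.instance Definition _ := gen_eqMixin betaomega.
HB.instance Definition _ := gen_choiceMixin betaomega.

Lemma betaomega_ext (u v : betaomega) :
  (forall A : set nat, u A -> v A) -> u = v.
Proof.
case: u v => [F FU] [G GU] /= FG.
have GF : G = F by apply: max_filter FG.
by case: _ / GF FU {FG} => FU; congr BetaOmega; exact: Prop_irrelevance.
Qed.

Lemma ultraW (T : Type) (F : set_system T) :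
  ProperFilter F -> (forall A, F A \/ F (~` A)) -> UltraFilter F.
Proof.
move=> FF FC; split=> // G GF FG; apply/seteqP; split=> // A GA.
have [//|/FG GnA] := FC A.
have /filter_ex[x []] : G (A `&` ~` A) by exact: filterI.
by [].
Qed.

Definition principal (n : nat) : betaomega :=
  BetaOmega (@principal_filter_ultra nat n).

(* The copy of omega inside betaomega: n is identified with [principal n]. *)
Definition omega : set betaomega := range principal.

Lemma principalE (n : nat) (A : set nat) : principal n A <-> A n.
Proof. exact: principal_filterP. Qed.

Definition basic_open (A : set nat) : set betaomega :=
  [set u : betaomega | u A].

Lemma basic_open_cover : \bigcup_(A in [set: set nat]) basic_open A = setT.
Proof.
by apply/seteqP; split=> // u _; exists setT => //; exact: filterT.
Qed.

Lemma basic_open_join (A B : set nat) (u : betaomega) :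
  [set: set nat] A -> [set: set nat] B -> basic_open A u -> basic_open B u ->
  exists C, [/\ [set: set nat] C, basic_open C u &
    basic_open C `<=` basic_open A `&` basic_open B].
Proof.
move=> _ _ uA uB; exists (A `&` B); split=> //; first exact: filterI.
by move=> v vAB; split; apply: filterS vAB => n [].
Qed.

(* The topology with base the sets [basic_open A], A ranging over all subsets
   of nat. *)
HB.instance Definition _ :=
  isBaseTopological.Build betaomega basic_open_cover basic_open_join.

Lemma open_basic_open (A : set nat) : open (basic_open A).
Proof. by exists [set A] => //; rewrite bigcup_set1. Qed.

Lemma nbhs_betaomegaE (u : betaomega) (B : set betaomega) :
  nbhs u B <-> exists2 A : set nat, u A & basic_open A `<=` B.
Proof.
rewrite nbhsE; split=> [[C [[D _ <-] [A DA uA]] CB]|[A uA AB]].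
  by exists A => // v vA; apply: CB; exists A.
by exists (basic_open A) => //; split=> //; exact: open_basic_open.
Qed.

Definition continuous_extension (f : nat -> betaomega)
    (F : betaomega -> betaomega) :=
  continuous F /\ forall n, F (principal n) = f n.

Lemma ex_unique_continuous_extension (f : nat -> betaomega) :
  exists! F, continuous_extension f F.
Proof.
have U (v : betaomega) : UltraFilter [set A | v [set n | f n A]].
  apply: ultraW.
    apply: Build_ProperFilter_ex; first by move=> A /= /filter_ex[n /= /filter_ex].
    split=> [|A B /= vA vB|A B AB /= vA] /=.
    - by apply: filterS filterT => n _; exact: filterT.
    - by apply: filterS2 vA vB => n; exact: filterI.
    - by apply: filterS vA => n; exact: filterS.
  move=> A; have [?|vC] := @in_ultra_setVsetC _ v [set n | f n A] _; first by left.
  right; apply: filterS vC => n nA.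
  by have [|//] := @in_ultra_setVsetC _ (f n) A _.
pose F v := BetaOmega (U v); exists F; split=> [|G [Gc Gf]].
  split=> [v B /nbhs_betaomegaE[A FvA AB]|n].
    apply/nbhs_betaomegaE; exists [set n | f n A] => // w wA.
    exact: AB.
  by apply/esym/betaomega_ext => A fnA; exact/principalE.
apply/funext => v; apply/betaomega_ext => A FvA.
have [//|GnA] := @in_ultra_setVsetC _ (G v) A _.
have /Gc/nbhs_betaomegaE[B vB BG] : nbhs (G v) (basic_open (~` A)).
  by apply/nbhs_betaomegaE; exists (~` A).
have /filter_ex[n [Bn fnA]] : v (B `&` [set n | f n A]) by exact: filterI.
have : G (principal n) (~` A) by apply: BG; exact/principalE.
rewrite Gf => fnC.
have /filter_ex[k []] : f n (A `&` ~` A) by exact: filterI.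
by [].
Qed.

(* The continuous extension of f; existence and uniqueness come from the
   preceding lemma, and [ultra_ext1P] is the characterization. *)
Definition ultra_ext1 (f : nat -> betaomega) : betaomega -> betaomega :=
  sval (cid (ex_unique_continuous_extension f)).

Lemma ultra_ext1P (f : nat -> betaomega) :
  unique (continuous_extension f) (ultra_ext1 f).
Proof. exact: svalP (cid (ex_unique_continuous_extension f)). Qed.

Definition ultra_ext2_sets (g : nat * nat -> nat) (v w : betaomega) :
    set (set nat) :=
  [set S | v [set x | w [set y | S (g (x, y))]]].

Lemma ultra_ext2_setsP (g : nat * nat -> nat) (v w : betaomega) :
  UltraFilter (ultra_ext2_sets g v w).
Proof.
apply: ultraW.
  apply: Build_ProperFilter_ex.
    by rewrite /ultra_ext2_sets => A /= /filter_ex[x /= /filter_ex[y /= ?]]; exists (g (x, y)).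
  rewrite /ultra_ext2_sets; split=> [|A B /= vA vB|A B AB /= vA] /=.
  - by apply: filterS filterT => n _; apply: filterS filterT.
  - by apply: filterS2 vA vB => n; apply: filterS2 => m.
  - by apply: filterS vA => n; apply: filterS => m; exact: AB.
move=> A; pose P := [set x | w [set y | A (g (x, y))]].
have [?|vC] := @in_ultra_setVsetC _ v P _; first by left.
right; apply: filterS vC => x nA.
by have [//|] := @in_ultra_setVsetC _ w [set y | A (g (x, y))] _.
Qed.

Definition ultra_ext2 (g : nat * nat -> nat) (v w : betaomega) : betaomega :=
  BetaOmega (ultra_ext2_setsP g v w).

Definition weak_P_point (u : betaomega) :=
  ~ omega u /\
  forall A : set betaomega, countable A -> A `<=` ~` (omega `|` [set u]) ->
    ~ closure A u.

(* Main.v *)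
Require Import Defs.
From mathcomp Require Import all_boot all_order all_algebra.
From mathcomp Require Import all_classical topology.

(** For g : nat * nat -> nat, the map v |-> g~(v, w) is the continuous extension
    of i |-> g~(i, w), so (iia) and (iib) specialize to (iiia) and (iiib).
    Conversely, every sequence f of ultrafilters has this form: if p_i x is the
    i-th entry of the finite sequence coded by x, then the sets p_i^-1(B) with
    B in f(i) have the finite intersection property, and for any ultrafilter w
    containing all of them p_i maps w to f(i).  Applied to an enumeration of a
    countable set of nonprincipal ultrafilters clustering at u, this refutes
    (iiia). *)

Set Implicit Arguments.
Unset Strict Implicit.
Unset Printing Implicit Defensive.

Local Open Scope classical_set_scope.

Lemma betaomega_meet (u : betaomega) (A B : set nat) :
  u A -> u B -> exists n, A n /\ B n.
Proof. by move=> uA uB; exact: (filter_ex (filterI uA uB)). Qed.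

(** Left to right, continuity at [v] gives a set in [v] whose principal ultrafilters are sent into
    [basic_open A]; the converse applies this to the complement of [A]. *)
Lemma ultra_ext1E (f : nat -> betaomega) (v : betaomega) (A : set nat) :
  ultra_ext1 f v A <-> v [set n | f n A].
Proof.
have [[fc fE] _] := ultra_ext1P f.
have aux B : ultra_ext1 f v B -> v [set n | f n B].
  move=> fvB; have /fc/nbhs_betaomegaE[C vC CB] :
    nbhs (ultra_ext1 f v) (basic_open B) by apply/nbhs_betaomegaE; exists B.
  apply: filterS vC => n Cn; rewrite /= -fE; apply: CB; exact/principalE.
split=> [/aux//|vA]; have [//|/aux vnA] := @in_ultra_setVsetC _ (ultra_ext1 f v) A _.
have [n [fnA fnC]] := betaomega_meet vA vnA.
by have [k []] := betaomega_meet fnA fnC.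
Qed.

Lemma ultra_ext2E (g : nat * nat -> nat) (v w : betaomega) :
  ultra_ext2 g v w = ultra_ext1 (fun i => ultra_ext2 g (principal i) w) v.
Proof.
apply: betaomega_ext => A gA; apply/ultra_ext1E.
have : v [set x | w [set y | A (g (x, y))]] by exact: gA.
by apply: filterS => n wn; exact/principalE.
Qed.

Lemma ultra_ext1_closure (f : nat -> betaomega) (v : betaomega) (B : set nat) :
  v B -> closure (f @` B) (ultra_ext1 f v).
Proof.
move=> vB C /nbhs_betaomegaE[A /ultra_ext1E vA AC].
have [n [Bn fnA]] := betaomega_meet vB vA.
by exists (f n); split; [exists n | exact: AC].
Qed.

(** Since [u] is in the closure, the sets [[set n | f n A]] with [A] in [u] are nonempty and form a
    filter base; any ultrafilter containing them serves as [v]. *)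
Lemma closure_ultra_ext1 (f : nat -> betaomega) (u : betaomega) :
  closure (range f) u -> exists v, u = ultra_ext1 f v.
Proof.
move=> uf; pose F := filter_from u (fun A => [set n | f n A]).
have FF : ProperFilter F.
  apply: filter_from_proper; first apply: filter_from_filter.
  - by exists setT; exact: filterT.
  - move=> A B uA uB; exists (A `&` B); first exact: filterI.
    by move=> n fAB; split; apply: filterS fAB => k [].
  - move=> A uA; have /uf[_ [[n _ <-] fnA]] : nbhs u (basic_open A).
      by apply/nbhs_betaomegaE; exists A.
    by exists n.
have [G [GU FG]] := ultraFilterLemma FF.
exists (BetaOmega GU); apply: betaomega_ext => A uA.
by apply/ultra_ext1E; apply: FG; exists A.
Qed.

Lemma ex_ultra_ext2_principal (f : nat -> betaomega) :
  exists g w, forall i, ultra_ext2 g (principal i) w = f i.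
Proof.
pose p (i x : nat) := nth 0 (CodeSeq.decode x) i.
(* A pair [(m, B)] encodes a finite intersection: only the coordinates below [m] are constrained, so
   a code of a sequence of length [m] can meet them all. *)
pose D := [set mB : nat * (nat -> set nat) | forall i, f i (mB.2 i)].
pose E (mB : nat * (nat -> set nat)) :=
  [set x | forall i, (i < mB.1)%N -> mB.2 i (p i x)].
have FF : ProperFilter (filter_from D E).
  apply: filter_from_proper; first apply: filter_from_filter.
  - by exists (0, fun=> setT) => i; exact: filterT.
  - move=> [m B] [k C] DB DC; exists (maxn m k, fun i => B i `&` C i).
      by move=> i; apply: filterI; [exact: DB | exact: DC].
    move=> x Ex; split=> i /= ltim.
      by have [] : (B i `&` C i) (p i x) by apply: Ex; rewrite /= leq_max ltim.
    by have [] : (B i `&` C i) (p i x) by apply: Ex; rewrite /= leq_max ltim orbT.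
  - move=> [m B] DB; have [b Bb] := choice (fun i => filter_ex (DB i)).
    exists (CodeSeq.code (mkseq b m)) => i /= ltim.
    by rewrite /p CodeSeq.codeK nth_mkseq //; exact: Bb.
have [G [GU FG]] := ultraFilterLemma FF.
exists (fun ix => p ix.1 ix.2), (BetaOmega GU) => i.
apply/esym/betaomega_ext => A fiA; apply/principalE; apply: FG.
(* The bound [i.+1] is the least that reaches coordinate [i], the only one restricted. *)
exists (i.+1, fun j => if j == i then A else setT).
  by move=> j /=; case: eqP => [->|_] //; exact: filterT.
by move=> x /(_ i (ltnSn i)) /=; rewrite eqxx.
Qed.

(** Otherwise [v] contains both complements, and [u] lies in the closure of the countable image
    under [f] of their intersection, which avoids [u] and [omega]. *)
Lemma weak_P_point_ultra_ext1 (u : betaomega) (f : nat -> betaomega)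
    (v : betaomega) : weak_P_point u -> u = ultra_ext1 f v ->
  v [set i | f i = u] \/ v [set i | omega (f i)].
Proof.
move=> [_ uP] uE.
have [?|vu] := @in_ultra_setVsetC _ v [set i | f i = u] _; first by left.
have [?|vo] := @in_ultra_setVsetC _ v [set i | omega (f i)] _; first by right.
have /(@ultra_ext1_closure f) : v (~` [set i | f i = u] `&` ~` [set i | omega (f i)]).
  exact: filterI.
rewrite -uE => /uP [] //; first exact: card_le_trans (card_image_le _ _) (countableP _).
by move=> _ [i [fiu fio] <-] [].
Qed.

Lemma ultra_ext2_weak_P_point (u : betaomega) : ~ omega u ->
  (forall g v w, u = ultra_ext2 g v w ->
     exists i, ultra_ext2 g (principal i) w = u \/
               omega (ultra_ext2 g (principal i) w)) ->
  weak_P_point u.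
Proof.
move=> nu uP; split=> // A /pfcard_geP[->|[h]] AN uA.
  by have /uA[? []] : nbhs u setT by exact: filterT.
have hA i : A (h i) by exact: funS.
have /closure_ultra_ext1[v uv] : closure (range h) u.
  by apply: closure_subset uA; exact: surj.
have [g [w gE]] := ex_ultra_ext2_principal h.
have [|i] := uP g v w; first by rewrite ultra_ext2E uv; congr ultra_ext1; exact/esym/funext.
by rewrite gE => hi; apply: (AN _ (hA i)); case: hi; [right|left].
Qed.

Theorem theorem1 (u : betaomega) (nonprincipal_u : ~ omega u) :
  [<-> (* (i) *)
       weak_P_point u;
       (* (iia) *)
       forall (f : nat -> betaomega) (v : betaomega),
         u = ultra_ext1 f v ->
         exists i : nat, f i = u \/ omega (f i);
       (* (iib) *)
       forall (f : nat -> betaomega) (v : betaomega),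
         u = ultra_ext1 f v ->
         v [set i : nat | f i = u] \/ v [set i : nat | omega (f i)];
       (* (iiia) *)
       forall (g : nat * nat -> nat) (v w : betaomega),
         u = ultra_ext2 g v w ->
         exists i : nat, ultra_ext2 g (principal i) w = u \/
                         omega (ultra_ext2 g (principal i) w);
       (* (iiib) *)
       forall (g : nat * nat -> nat) (v w : betaomega),
         u = ultra_ext2 g v w ->
         v [set i : nat | ultra_ext2 g (principal i) w = u] \/
         v [set i : nat | omega (ultra_ext2 g (principal i) w)]].
Proof.
have ultra_ex (f : nat -> betaomega) (v : betaomega) :
    v [set i | f i = u] \/ v [set i | omega (f i)] ->
    exists i, f i = u \/ omega (f i).
  by case=> /filter_ex[i fi]; exists i; [left|right].
(* Keeping [P] abstract covers both the existential and the large-set conclusions. *)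
have iia_iiia (P : (nat -> betaomega) -> betaomega -> Prop) :
    (forall f v, u = ultra_ext1 f v -> P f v) ->
    forall g v w, u = ultra_ext2 g v w ->
      P (fun i => ultra_ext2 g (principal i) w) v.
  by move=> uP g v w uE; apply: uP; rewrite uE ultra_ext2E.
have iiia_i := ultra_ext2_weak_P_point nonprincipal_u.
split; first by move=> uP f v /(weak_P_point_ultra_ext1 uP)/ultra_ex.
split.
  (* The step from (iia) to (iib) passes through (iiia) and (i). *)
  move=> iia f v; apply: weak_P_point_ultra_ext1; apply: iiia_i.
  exact: iia_iiia (fun f _ => exists i, f i = u \/ omega (f i)) iia.
split.
  move=> iib g v w /(iia_iiia _ iib); exact: ultra_ex.
split; last by move=> iiib; apply: iiia_i => g v w /iiib/ultra_ex.
move=> /iiia_i uP.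
exact: iia_iiia _ (fun f v => @weak_P_point_ultra_ext1 u f v uP).
Qed.
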